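(* For any permutation $\pi$ and any entangling $E$ of $\pi$, there exists $S \in \{+,-\}^{|\Lambda(E)|}$ for which the signed partition $P = (\Lambda(E), S)$ is unique. In particular, $d(\pi) \leq u(\pi)$ for any permutation $\pi$.
   Context: Let $\pi=(\pi_1,\dots,\pi_k)$ be a permutation of $[k]$. A consecutive subsequence is $\pi[i,j]=(\pi_i,\dots,\pi_j)$, $1\le i\le j\le k$; for such $\sigma$, $\min\sigma,\max\sigma$ denote its minimum and maximum values. Shadowed: let $\sigma=\pi[x,y]$ and $\sigma'=\pi[x',y']$ be disjoint consecutive subsequences of length at least two, and let $x'\le m,M\le y'$ be the indices with $\pi_m=\min\pi[x',y']$, $\pi_M=\max\pi[x',y']$. $\sigma'$ is shadowed with respect to $\sigma$ if one of: (i) $x'>y$, $m<M$, $\pi_{x'-1}>\pi_M$; (ii) $x'>y$, $m>M$, $\pi_{x'-1}<\pi_m$; (iii) $y'<x$, $m<M$, $\pi_{y'+1}<\pi_m$; (iv) $y'<x$, $m>M$, $\pi_{y'+1}>\pi_M$. Entangling: a collection $E=(\sigma_1,\dots,\sigma_t)$ of pairwise disjoint consecutive subsequences, $\sigma_i=\pi[a_i,b_i]$, such that (1) for each $2\le j\le t$: either $a_j>b_1$ and $\min_{i<j}\min\sigma_i<\pi_{a_j}<\max_{i<j}\max\sigma_i$, or $b_j<a_1$ and $\min_{i<j}\min\sigma_i<\pi_{b_j}<\max_{i<j}\max\sigma_i$; (2) for each $2\le j\le t$, $\sigma_j$ is not shadowed with respect to $\sigma_1$; (3) for every $1\le \ell\le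 k$ there is $\sigma\in E$ with $\min\sigma\le\ell\le\max\sigma$. $\Lambda(E)$ is the partition of $\pi$ into consecutive parts in which $\sigma_1,\dots,\sigma_t$ are parts and every element of $\pi$ not in $\bigcup_i\sigma_i$ is its own part; $d(E)=|\Lambda(E)|=k-\sum_{\sigma\in E}(|\sigma|-1)$, and $d(\pi)=\max_E d(E)$ over all entanglings. Signed partitions and uniqueness: a partition $\Lambda=(\sigma_1,\dots,\sigma_\ell)$ of $\pi$ splits it into consecutive parts $\sigma_i=\pi[r_{i-1}+1,r_i]$ ($r_0=0$, $r_\ell=k$, $k_i=r_i-r_{i-1}$). A signed partition $P=(\Lambda,S)$ has $S=(s_1,\dots,s_\ell)\in\{+,-\}^\ell$ with, for each $\sigma_i$ of length $>1$, $s_i=-$ if $\min\sigma_i$ appears before $\max\sigma_i$ in $\pi$ and $s_i=+$ otherwise. Define $f_P\colon[k^2]\to\mathbb{R}$ by $f_P(r_{i-1}k+mk_i+j)=m+\pi_{r_{i-1}+j}/(2k)$ if $s_i=+$ and $=(k-1-m)+\pi_{r_{i-1}+j}/(2k)$ if $s_i=-$ ($1\le i\le \ell$, $1\le j\le k_i$, $0\le m\le k-1$). A $\pi$-copy in a sequence $g$ is a set of indices $i_1<\dots<i_k$ with $g(i_a)<g(i_b)$ iff $\pi_a<\pi_b$. For each $m$, the entries $x$ with $m<f_P(x)<m+1$ form a trivial $\pi$-copy; $P$ is unique if $f_P$ has no non-trivial $\pi$-copy. $u(\pi)$ is the maximum size of a unique signed partition. *)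

(* Defs.v *)
From mathcomp Require Import all_boot all_order all_algebra all_fingroup.
From mathcomp Require Import boolp reals zify.

Set Implicit Arguments.
Unset Strict Implicit.
Unset Printing Implicit Defensive.

Import Order.TTheory GRing.Theory Num.Theory.

(* A permutation of [k] is an element of 'S_k, but positions and values are
   numbered from 1: [pval pi i] is pi_i in [k] for i in [k].  Its values at
   other positions are irrelevant. *)
Definition pval (k : nat) (pi : 'S_k) (i : nat) : nat :=
  if insub i.-1 is Some j then (pi j).+1 else 0.

(* The consecutive subsequence pi[a,b] is represented by the pair (a, b). *)
Definition segment : Type := (nat * nat)%type.

Definition is_segment (k : nat) (s : segment) : bool :=
  [&& 1 <= s.1, s.1 <= s.2 & s.2 <= k].

Definition seg_len (s : segment) : nat := s.2.+1 - s.1.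

Definition in_seg (i : nat) (s : segment) : bool := s.1 <= i <= s.2.

Definition seg_disjoint (s t : segment) : bool := (s.2 < t.1) || (t.2 < s.1).

Section Permutation.
Variables (k : nat) (pi : 'S_k).

Definition seg_vals (s : segment) : seq nat :=
  [seq pval pi i | i <- iota s.1 (seg_len s)].

Definition seg_min (s : segment) : nat :=
  \big[minn/pval pi s.1]_(v <- seg_vals s) v.

Definition seg_max (s : segment) : nat := \max_(v <- seg_vals s) v.

Definition argmin (s : segment) : nat :=
  s.1 + index (seg_min s) (seg_vals s).

Definition argmax (s : segment) : nat :=
  s.1 + index (seg_max s) (seg_vals s).

(* [shadowed s s']: s' is shadowed with respect to s. *)
Definition shadowed (s s' : segment) : Prop :=
  let m := argmin s' in
  let M := argmax s' in
  [/\ seg_disjoint s s', 2 <= seg_len s, 2 <= seg_len s' &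
      [\/ [/\ s'.1 > s.2, m < M & pval pi s'.1.-1 > pval pi M],
          [/\ s'.1 > s.2, m > M & pval pi s'.1.-1 < pval pi m],
          [/\ s'.2 < s.1, m < M & pval pi s'.2.+1 < pval pi m] |
          [/\ s'.2 < s.1, m > M & pval pi s'.2.+1 > pval pi M]]].

Definition fam_min (E : seq segment) : nat :=
  \big[minn/seg_min (head (0, 0) E)]_(s <- E) seg_min s.

Definition fam_max (E : seq segment) : nat := \max_(s <- E) seg_max s.

(* List indices start at 0, so sigma_j is at index j.-1, and
   [take j E] consists of the segments that precede index j. *)
Definition entangling (E : seq segment) : Prop :=
  let s1 := head (0, 0) E in
  [/\ all (is_segment k) E,
      pairwise seg_disjoint E,
      forall j, 1 <= j < size E ->
        let s := nth (0, 0) E j in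
        let lo := fam_min (take j E) in
        let hi := fam_max (take j E) in
        (s.1 > s1.2 /\ lo < pval pi s.1 < hi) \/
        (s.2 < s1.1 /\ lo < pval pi s.2 < hi),
      forall j, 1 <= j < size E -> ~ shadowed s1 (nth (0, 0) E j) &
      forall l, 1 <= l <= k ->
        exists2 s, s \in E & seg_min s <= l <= seg_max s].

(* Parts are listed from left to right; the right endpoints are
   r_1 < ... < r_l = k, and the i-th part is (r_(i-1) + 1, r_i). *)
Definition is_partition (L : seq segment) : bool :=
  let r := unzip2 L in
  [&& path ltn 0 r, last 0 r == k & L == pairmap (fun x y => (x.+1, y)) 0 r].

Definition Lambda (E : seq segment) : seq segment :=
  sort (fun s t => s.1 <= t.1)
       (E ++ [seq (i, i) | i <- iota 1 k & ~~ has (in_seg i) E]).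

Definition dE (E : seq segment) : nat := size (Lambda E).

(* The maximum of dE over all entanglings; dE E <= k by [dE_le]. *)
Definition d : nat :=
  \max_(n < k.+1 | `[< exists2 E, entangling E & dE E = n >]) n.

(* Signs are booleans: true is + and false is -. *)
Definition signed_partition (L : seq segment) (S : seq bool) : Prop :=
  [/\ is_partition L, size S = size L &
      forall i, i < size L ->
        let s := nth (0, 0) L i in
        1 < seg_len s -> nth true S i = ~~ (argmin s < argmax s)].

Section Reals.
Variable R : realType.
Local Open Scope ring_scope.

(* f_P as a function on {1, ..., k^2}.  The i-th part (a, b) occupies the
   indices in ((a-1)k, bk], i.e. those x with (x-1) %/ k + 1 in [a, b]; within
   them x = (a-1)k + m k_i + j is decomposed by Euclidean division by k_i.
   See [fPE] for the defining equation. *)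
Definition fP (L : seq segment) (S : seq bool) (x : nat) : R :=
  let i := find (in_seg (x.-1 %/ k).+1) L in
  let s := nth (0%N, 0%N) L i in
  let r := s.1.-1 in
  let ki := seg_len s in
  let y := (x.-1 - r * k)%N in
  let m := (y %/ ki)%N in
  let j := (y %% ki).+1 in
  (if nth true S i then m else (k - 1 - m)%N)%:R
  + (pval pi (r + j))%:R / (2 * k)%:R.

(* A pi-copy in g(1), ..., g(n) is given by the increasing list c of its
   indices. *)
Definition copy (n : nat) (g : nat -> R) (c : seq nat) : Prop :=
  [/\ size c = k, sorted ltn c, all (fun x => 1 <= x <= n)%N c &
      forall a b, (1 <= a <= k)%N -> (1 <= b <= k)%N ->
        (g (nth 0%N c a.-1) < g (nth 0%N c b.-1)) = (pval pi a < pval pi b)%N].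

Definition trivial_copy (n : nat) (g : nat -> R) (c : seq nat) : Prop :=
  exists2 m, (m < k)%N &
    forall x, (x \in c) = (1 <= x <= n)%N && (m%:R < g x < m.+1%:R).

Definition unique (L : seq segment) (S : seq bool) : Prop :=
  forall c, copy (k ^ 2) (fP L S) c -> trivial_copy (k ^ 2) (fP L S) c.

(* The maximum of size L over all unique signed partitions (L, S); size L <= k
   by [partition_size_le]. *)
Definition u : nat :=
  (\max_(n < k.+1 | `[< exists L S,
      [/\ signed_partition L S, unique L S & size L = n] >]) n)%N.

End Reals.

Lemma path_ltn_size x (r : seq nat) : path ltn x r -> x + size r <= last x r.
Proof.
elim: r x => [|y r IH] x /=; first by rewrite addn0.
move=> /andP[xy /IH]; apply: leq_trans.
by rewrite addnS -addSn leq_add2r.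
Qed.

Lemma partition_size_le L : is_partition L -> size L <= k.
Proof.
case/and3P=> /path_ltn_size + /eqP lastr _.
by rewrite lastr add0n size_map.
Qed.

Lemma count_in_seg s : is_segment k s ->
  count (in_seg^~ s) (iota 1 k) = seg_len s.
Proof.
case: s => a b /and3P[/= a1 ab bk].
have -> : iota 1 k = iota 1 a.-1 ++ iota a (b.+1 - a) ++ iota b.+1 (k - b).
  have -> : k = a.-1 + ((b.+1 - a) + (k - b)) by lia.
  rewrite iotaD iotaD; congr (_ ++ (iota _ _ ++ iota _ _)); lia.
rewrite !count_cat.
rewrite (@eq_in_count _ _ pred0 (iota 1 _)) ?count_pred0; last first.
  move=> i; rewrite mem_iota add1n prednK // => /andP[_ ia].
  by rewrite /in_seg /= leqNgt ia.
rewrite (@eq_in_count _ _ predT (iota a _)) ?count_predT; last first.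
  by move=> i; rewrite mem_iota /in_seg /=; lia.
rewrite (@eq_in_count _ _ pred0 (iota b.+1 _)) ?count_pred0; last first.
  move=> i; rewrite mem_iota => /andP[bi _].
  by rewrite /in_seg /= [i <= b]leqNgt bi andbF.
by rewrite size_iota add0n addn0.
Qed.

Lemma count_covered E : all (is_segment k) E -> pairwise seg_disjoint E ->
  count (fun i => has (in_seg i) E) (iota 1 k) = \sum_(s <- E) seg_len s.
Proof.
elim: E => [|s E IH] /=; first by rewrite big_nil count_pred0.
move=> /andP[sk Ek] /andP[/allP sE dE0]; rewrite big_cons -IH // -count_in_seg //.
rewrite -count_predUI.
rewrite -[LHS]addn0; congr (_ + _); apply/esym/eqP; rewrite -leqn0 leqNgt -has_count.
apply/hasPn => i _ /=; apply/negP => /andP[/andP[ai ib] /hasP[t tE /andP[ci id']]].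
case/orP: (sE _ tE) => lt.
  by move: (leq_trans (leq_ltn_trans ib lt) ci); rewrite ltnn.
by move: (leq_trans (leq_ltn_trans id' lt) ai); rewrite ltnn.
Qed.

Lemma dE_formula E : entangling E ->
  dE E + \sum_(s <- E) (seg_len s - 1) = k.
Proof.
case=> Ek Ed _ _ _.
rewrite /dE size_sort size_cat size_map size_filter.
have := count_predC (fun i => has (in_seg i) E) (iota 1 k).
rewrite size_iota count_covered // => kE; rewrite -[RHS]kE.
rewrite addnAC; congr (_ + _).
rewrite -sum1_size -big_split /=; apply: eq_big_seq => s /(allP Ek).
by case/and3P=> _ ab _; rewrite subnKC // /seg_len subn_gt0 ltnS.
Qed.

Lemma dE_le E : entangling E -> dE E <= k.
Proof. by move/dE_formula; lia. Qed.

Lemma is_partition_nth L i : is_partition L -> i < size L ->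
  let s := nth (0, 0) L i in
  [/\ s.1 = (nth 0 (0 :: unzip2 L) i).+1, s.1 <= s.2 & s.2 <= k].
Proof.
case/and3P=> pL /eqP lL /eqP eL iL /=.
have ir : i < size (unzip2 L) by rewrite size_map.
have e2 : (nth (0, 0) L i).2 = nth 0 (unzip2 L) i by rewrite (nth_map (0, 0)).
have e1 : (nth (0, 0) L i).1 = (nth 0 (0 :: unzip2 L) i).+1.
  by rewrite {1}eL (nth_pairmap 0).
split=> //; first by rewrite e1 e2; move/(pathP 0): pL => /(_ i ir).
have sr : sorted ltn (0 :: unzip2 L) by [].
rewrite e2 -lL (last_nth 0).
have := sorted_leq_nth leq_trans leqnn 0
  (sub_sorted (fun x y => @ltnW x y) sr).
by move/(_ i.+1 (size (unzip2 L))); apply; rewrite ?inE //=.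
Qed.

Lemma is_partition_find L i c : is_partition L -> i < size L ->
  in_seg c (nth (0, 0) L i) -> find (in_seg c) L = i.
Proof.
move=> pL iL ci.
have hasc : has (in_seg c) L by apply/hasP; exists (nth (0, 0) L i); rewrite ?mem_nth.
have fi : find (in_seg c) L <= i by rewrite leqNgt; apply/negP => /(before_find (0, 0)); rewrite ci.
apply/eqP; rewrite eqn_leq fi leqNgt; apply/negP => lt.
have := nth_find (0, 0) hasc; set h := find _ _ in fi lt *.
case/andP=> _ ch; case/andP: ci => ic _.
have [e1 _ _] := is_partition_nth pL iL.
have hL : h < size L by rewrite -has_find.
have sr : sorted ltn (0 :: unzip2 L) by case/and3P: pL.
have := sorted_leq_nth leq_trans leqnn 0
  (sub_sorted (fun x y => @ltnW x y) sr).
move/(_ h.+1 i); rewrite !inE /= size_map => /(_ _ _ lt).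
rewrite ltnS hL ltnS (ltnW iL) => /(_ isT isT) le.
have e2 : (nth (0, 0) L h).2 = nth 0 (unzip2 L) h by rewrite (nth_map (0, 0)).
by move: (leq_trans ic ch); rewrite e1 e2 ltnNge le.
Qed.

Lemma fPE (R : realType) L S i m j : is_partition L -> i < size L ->
  let s := nth (0, 0) L i in
  let r := s.1.-1 in
  let ki := seg_len s in
  m < k -> 1 <= j <= ki ->
  (fP R L S (r * k + m * ki + j) =
   (if nth true S i then m else (k - 1 - m)%N)%:R
   + (pval pi (r + j))%:R / (2 * k)%:R)%R.
Proof.
move=> pL iL s r ki mk /andP[j1 jk].
have [e1 ab bk] := is_partition_nth pL iL; rewrite -/s in e1 ab bk.
have k0 : 0 < k by apply: leq_ltn_trans mk.
have rE : r.+1 = s.1 by rewrite /r e1.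
have xE : (r * k + m * ki + j).-1 = r * k + (m * ki + j.-1).
  by rewrite -addnA -{1}(prednK j1) !addnS.
have lt : m * ki + j.-1 < ki * k.
  have : m.+1 * ki <= k * ki by rewrite leq_mul2r mk orbT.
  rewrite mulSn [k * ki]mulnC; lia.
rewrite /fP xE.
have -> : find (in_seg ((r * k + (m * ki + j.-1)) %/ k).+1) L = i.
  apply: is_partition_find => //; rewrite -/s /in_seg divnMDl // -rE ltnS leq_addr /=.
  have := lt; rewrite -ltn_divLR // => lt'.
  have -> : s.2 = r + ki by rewrite /ki /seg_len; lia.
  by rewrite ltn_add2l.
rewrite -/s -/r -/ki addKn.
have ki0 : 0 < ki by apply: leq_trans jk.
have jlt : j.-1 < ki by rewrite prednK.
by rewrite divnMDl // divn_small // addn0 modnMDl modn_small // prednK.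
Qed.

End Permutation.

(* Main.v *)
From mathcomp Require Import all_boot all_order all_algebra all_fingroup.
From mathcomp Require Import boolp reals zify.
Require Import Defs.

Set Implicit Arguments.
Unset Strict Implicit.
Unset Printing Implicit Defensive.

Import Order.TTheory GRing.Theory Num.Theory.

(** The [p]-th element of a pi-copy in [f_P] is the entry of some level [lev p]
    above some position [col p] of [pi].  In the block of a part [s] the levels run
    up or down according to the sign of [s], so two elements of the copy that lie
    above [s] have equal levels whenever their positions form an inversion exactly
    if the sign of [s] is [+].  By definition of the signs this applies to the
    positions of the minimum and the maximum of [s], and, since no part in the
    entangling is shadowed, to some position of [s] and the neighbor of [s] on the
    side of [sigma_1].  Hence the elements at the positions of [s] and at that
    neighbor cannot all lie above [s]: they would share a level, which has only [|s|]
    entries there.  Going from the ends of [pi] towards [sigma_1], this traps the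
    elements at the positions of [sigma_1] above [sigma_1], so they belong to the
    trivial copy of some level.  So do the elements whose values lie between two of
    them, in particular the one at the near end of [sigma_2], which traps the
    elements at the positions of [sigma_2] above [sigma_2], and so on along the
    entangling.  Since the value ranges cover [[k]], the copy is trivial. *)

Lemma big_selective_mem (T : eqType) (op : T -> T -> T) (x0 : T) (s : seq T) :
  (forall x y, op x y \in [:: x; y]) -> \big[op/x0]_(v <- s) v \in x0 :: s.
Proof.
move=> op_sel; elim: s => [|v s IH]; first by rewrite big_nil mem_head.
rewrite big_cons; move: (op_sel v (\big[op/x0]_(w <- s) w)) IH.
by rewrite !inE => /orP[]/eqP-> => [|/orP[]->]; rewrite ?eqxx ?orbT.
Qed.

Lemma bigminn_mem x0 (s : seq nat) :
  x0 \in s -> \big[minn/x0]_(v <- s) v \in s.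
Proof.
move=> x0s; have minn_sel x y : minn x y \in [:: x; y].
  by rewrite !inE /minn; case: ifP; rewrite eqxx ?orbT.
by have := big_selective_mem x0 s minn_sel; rewrite inE => /predU1P[->|].
Qed.

Lemma bigmaxn_mem x (s : seq nat) : x \in s -> \max_(v <- s) v \in s.
Proof.
move=> xs; have maxn_sel y z : maxn y z \in [:: y; z].
  by rewrite !inE /maxn; case: ifP; rewrite eqxx ?orbT.
have := big_selective_mem 0 s maxn_sel; rewrite inE => /predU1P[max0|//].
by have := @leq_bigmax_seq _ s xpredT id x xs isT; rewrite max0 leqn0 => /eqP <-.
Qed.

Lemma bigminn_le x0 (s : seq nat) x :
  x \in s -> \big[minn/x0]_(v <- s) v <= x.
Proof. by move=> xs; exact: (@ge_bigmin_seq _ nat _ s x0 x xpredT id). Qed.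

Lemma index_head_gt0 (T : eqType) (x0 x : T) (s : seq T) :
  x \in s -> x != head x0 s -> 0 < index x s.
Proof. by case: s => //= y s _; rewrite eq_sym; case: eqP. Qed.

Lemma increasing_gap (f : nat -> nat) a b :
  {in [pred p | a <= p <= b] &, {homo f : p q / p < q}} -> a <= b ->
  f a + (b - a) <= f b.
Proof.
move=> f_incr ab.
suff gap n : a + n <= b -> f a + n <= f (a + n).
  by rewrite -{2}(subnKC ab) gap ?subnKC.
elim: n => [|n IH] anb; first by rewrite !addn0.
by have := f_incr (a + n) (a + n.+1); rewrite !inE; lia.
Qed.

Lemma increasing_fixed (f : nat -> nat) a b :
  {in [pred p | a <= p <= b] &, {homo f : p q / p < q}} -> a <= f a -> f b <= b ->
  {in [pred p | a <= p <= b], f =1 id}.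
Proof.
move=> f_incr fa fb p; rewrite inE => /andP[ap pb].
have gap c d : a <= c -> c <= d -> d <= b -> f c + (d - c) <= f d.
  move=> ac cd db; apply: increasing_gap => // q r.
  by rewrite !inE => qcd rcd; apply: f_incr; rewrite inE; lia.
by have := gap a p; have := gap p b; lia.
Qed.

(** * Permutation values and segments *)

Lemma pval_ord k (pi : 'S_k) (i : 'I_k) : pval pi i.+1 = (pi i).+1.
Proof. by rewrite /pval insubT //= => ik; congr (pi _).+1; apply: val_inj. Qed.

Section Values.
Variables (k : nat) (pi : 'S_k).

Lemma pval_bounds p : 1 <= p <= k -> 1 <= pval pi p <= k.
Proof.
by case: p => // p pk; have /= -> := pval_ord pi (Ordinal pk); rewrite /= ltn_ord.
Qed.

Lemma pvalK p : 1 <= p <= k -> pval pi^-1%g (pval pi p) = p.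
Proof.
case: p => // p pk; have /= -> := pval_ord pi (Ordinal pk).
by rewrite pval_ord permK.
Qed.

Lemma pval_inj : {in [pred p | 1 <= p <= k] &, injective (pval pi)}.
Proof. by move=> p q pk qk eq_pq; rewrite -(pvalK pk) eq_pq pvalK. Qed.

Lemma pval_ltNgt p q : 1 <= p <= k -> 1 <= q <= k -> p != q ->
  (pval pi p < pval pi q) = ~~ (pval pi q < pval pi p).
Proof.
move=> pk qk pNq; case: ltngtP => // eq_pq.
by rewrite (pval_inj pk qk eq_pq) eqxx in pNq.
Qed.

Definition inversion (p q : nat) : bool := (p < q) (+) (pval pi p < pval pi q).

Lemma inversionC p q : 1 <= p <= k -> 1 <= q <= k ->
  inversion p q = inversion q p.
Proof.
move=> pk qk; have [-> //|pNq] := eqVneq p q.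
rewrite /inversion (pval_ltNgt pk qk pNq) addbN -addNb; congr (_ (+) _).
by case: ltngtP pNq.
Qed.

End Values.

Lemma pvalVK k (pi : 'S_k) v : 1 <= v <= k -> pval pi (pval pi^-1%g v) = v.
Proof. by move=> vk; rewrite -{1}(invgK pi) pvalK. Qed.

Section Segment.
Variables (k : nat) (pi : 'S_k) (s : segment).
Hypothesis sk : is_segment k s.

Lemma is_segment_bounds : [/\ 1 <= s.1, s.1 <= s.2 & s.2 <= k].
Proof. exact/and3P. Qed.

Lemma in_seg_bounds p : in_seg p s -> 1 <= p <= k.
Proof. by case: is_segment_bounds; rewrite /in_seg; lia. Qed.

Lemma in_seg_left : in_seg s.1 s.
Proof. by case: is_segment_bounds; rewrite /in_seg; lia. Qed.

Lemma in_seg_right : in_seg s.2 s.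
Proof. by case: is_segment_bounds; rewrite /in_seg; lia. Qed.

Lemma extend_segment e : 1 <= e <= k -> e = s.1.-1 \/ e = s.2.+1 ->
  exists a b, [/\ 1 <= a, a <= b, b <= k, seg_len s <= b - a &
                  forall p, a <= p <= b -> in_seg p s \/ p = e].
Proof.
move=> ek; have [? ? ?] := is_segment_bounds; rewrite /seg_len /in_seg.
by case=> eE; [exists e, s.2|exists s.1, e]; split; lia.
Qed.

Lemma mem_seg_vals p : in_seg p s -> pval pi p \in seg_vals pi s.
Proof.
move=> ps; apply: map_f; rewrite mem_iota; move: ps.
by rewrite /in_seg /seg_len; lia.
Qed.

Lemma seg_vals_index v : v \in seg_vals pi s ->
  in_seg (s.1 + index v (seg_vals pi s)) s /\
  pval pi (s.1 + index v (seg_vals pi s)) = v.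
Proof.
move=> vs; have := vs; rewrite -index_mem size_map size_iota => lt_len.
split; first by move: lt_len; rewrite /in_seg /seg_len; lia.
by rewrite -[RHS](nth_index 0 vs) (nth_map 0) ?size_iota // nth_iota.
Qed.

Lemma argminP : in_seg (argmin pi s) s /\ pval pi (argmin pi s) = seg_min pi s.
Proof. by apply/seg_vals_index/bigminn_mem/mem_seg_vals/in_seg_left. Qed.

Lemma argmaxP : in_seg (argmax pi s) s /\ pval pi (argmax pi s) = seg_max pi s.
Proof. by apply/seg_vals_index/bigmaxn_mem/mem_seg_vals/in_seg_left. Qed.

Lemma seg_min_max p : in_seg p s -> seg_min pi s <= pval pi p <= seg_max pi s.
Proof.
by move/mem_seg_vals => ps; rewrite bigminn_le //= (@leq_bigmax_seq _ _ xpredT id).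
Qed.

Lemma seg_min_lt_max : (seg_min pi s < seg_max pi s) = (1 < seg_len s).
Proof.
have [? ? ?] := is_segment_bounds; apply/idP/idP => [|len].
  have [+ <-] := argminP; have [+ <-] := argmaxP.
  rewrite /in_seg => Ms ms; apply: contraTT; rewrite -!leqNgt /seg_len => len.
  by have -> : argmax pi s = argmin pi s by lia.
have := seg_min_max in_seg_left; have := seg_min_max in_seg_right.
have : pval pi s.1 != pval pi s.2.
  apply: contraTneq len => /pval_inj eq_ends; rewrite -leqNgt /seg_len.
  by rewrite eq_ends ?inE; lia.
by lia.
Qed.

Lemma pval_argmin_lt_argmax :
  (pval pi (argmin pi s) < pval pi (argmax pi s)) = (1 < seg_len s).
Proof. by have [_ ->] := argminP; have [_ ->] := argmaxP; exact: seg_min_lt_max. Qed.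

Lemma inversion_argmin_argmax : 1 < seg_len s ->
  inversion pi (argmin pi s) (argmax pi s) = ~~ (argmin pi s < argmax pi s).
Proof. by move=> len; rewrite /inversion pval_argmin_lt_argmax len addbT. Qed.

End Segment.

Lemma fam_min_attained k (pi : 'S_k) E : all (is_segment k) E -> E != [::] ->
  exists2 p, has (in_seg p) E & pval pi p = fam_min pi E.
Proof.
move=> Ek E0; have : fam_min pi E \in map (seg_min pi) E.
  rewrite /fam_min -(big_map (seg_min pi) xpredT id) bigminn_mem //.
  by case: E E0 {Ek} => //= s E _; rewrite mem_head.
case/mapP => s sE ->; have [ps <-] := argminP pi (allP Ek _ sE).
by exists (argmin pi s) => //; apply/hasP; exists s.
Qed.

Lemma fam_max_attained k (pi : 'S_k) E : all (is_segment k) E -> E != [::] ->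
  exists2 p, has (in_seg p) E & pval pi p = fam_max pi E.
Proof.
move=> Ek E0; have : fam_max pi E \in map (seg_max pi) E.
  rewrite /fam_max -(big_map (seg_max pi) xpredT id).
  case: E E0 {Ek} => // s E _; apply: (@bigmaxn_mem (seg_max pi s)).
  exact: mem_head.
case/mapP => s sE ->; have [ps <-] := argmaxP pi (allP Ek _ sE).
by exists (argmax pi s) => //; apply/hasP; exists s.
Qed.

(** * Shadowing *)

Definition neighbor_toward (s t : segment) : nat :=
  if s.2 < t.1 then t.1.-1 else t.2.+1.

Lemma neighbor_toward_adjacent s t :
  neighbor_toward s t = t.1.-1 \/ neighbor_toward s t = t.2.+1.
Proof. by rewrite /neighbor_toward; case: ifP; [left|right]. Qed.

(* Either sign is allowed for a part of length one; the one chosen here makes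
   [sign_inversion_entangling] hold for it as well. *)
Definition sign_toward k (pi : 'S_k) (s t : segment) : bool :=
  if 1 < seg_len t then inversion pi (argmin pi t) (argmax pi t)
  else inversion pi t.1 (neighbor_toward s t).

Section Neighbor.
Variables (k : nat) (pi : 'S_k) (s t : segment).
Hypotheses (sk : is_segment k s) (tk : is_segment k t) (st : seg_disjoint s t).

Lemma neighbor_toward_bounds : 1 <= neighbor_toward s t <= k.
Proof.
have [? ? ?] := is_segment_bounds sk; have [? ? ?] := is_segment_bounds tk.
by move: st; rewrite /seg_disjoint /neighbor_toward; case: ifP; lia.
Qed.

Lemma neighbor_toward_notin p : in_seg p t -> p != neighbor_toward s t.
Proof.
have [? ? ?] := is_segment_bounds tk.
by rewrite /in_seg /neighbor_toward; case: ifP; lia.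
Qed.

Lemma inversion_neighbor_toward p : in_seg p t ->
  inversion pi p (neighbor_toward s t) =
  if s.2 < t.1 then pval pi p < pval pi (neighbor_toward s t)
  else pval pi (neighbor_toward s t) < pval pi p.
Proof.
move=> pt; have pNe := neighbor_toward_notin pt.
have pk := in_seg_bounds tk pt; have ek := neighbor_toward_bounds.
rewrite /inversion (pval_ltNgt pi pk ek pNe) {1}/neighbor_toward.
have [? ? ?] := is_segment_bounds tk; move: pt; rewrite /in_seg => pt.
case: ifP => st_right; first by have -> : (p < t.1.-1) = false by lia.
have -> : p < t.2.+1 by lia.
by rewrite addTb negbK.
Qed.

(* If neither [argmin pi t] nor [argmax pi t] is such a [p], then [t] is shadowed. *)
Lemma not_shadowed_inversion : 1 < seg_len s -> 1 < seg_len t ->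
  ~ shadowed pi s t ->
  exists2 p, in_seg p t & inversion pi p (neighbor_toward s t) =
                          inversion pi (argmin pi t) (argmax pi t).
Proof.
move=> len_s len_t; apply: contra_notP => no_inv; split=> //.
have [m_t _] := argminP pi tk; have [M_t _] := argmaxP pi tk.
have := pval_argmin_lt_argmax pi tk; rewrite len_t => mM.
have e_inv p : in_seg p t -> inversion pi p (neighbor_toward s t) !=
    ~~ (argmin pi t < argmax pi t).
  move=> pt; apply/eqP => inv_p; apply: no_inv.
  by exists p; rewrite // inversion_argmin_argmax.
have e_val p : in_seg p t -> pval pi p != pval pi (neighbor_toward s t).
  move=> pt; apply: contra (neighbor_toward_notin pt) => /eqP/pval_inj -> //.
    exact: in_seg_bounds pt.
  exact: neighbor_toward_bounds.
have := e_inv _ m_t; have := e_inv _ M_t.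
have := e_val _ m_t; have := e_val _ M_t.
rewrite !inversion_neighbor_toward // /neighbor_toward.
move: st; rewrite /seg_disjoint; case: ifP => [right _|_ /= left];
  case: (ltngtP (argmin pi t) (argmax pi t)) mM => [lt_mM|lt_Mm|->] lt_vals;
  rewrite ?ltnn //= in lt_vals *.
- by move=> *; apply: Or41; split; lia.
- by move=> *; apply: Or42; split; lia.
- by move=> *; apply: Or43; split; lia.
- by move=> *; apply: Or44; split; lia.
Qed.

End Neighbor.

(** * Partitions into segments *)

Definition precedes (s t : segment) : bool := s.2 < t.1.

Lemma precedes_trans :
  {in [pred s : segment | s.1 <= s.2] & &, transitive precedes}.
Proof. by move=> t s u; rewrite !inE /precedes; lia. Qed.

Lemma pairwise_disjoint_in E (s t : segment) : pairwise seg_disjoint E ->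
  s \in E -> t \in E -> s != t -> seg_disjoint s t.
Proof.
move=> Ed sE tE sNt.
pose eq_or_disjoint : rel segment := fun x y => (x == y) || seg_disjoint x y.
suff : eq_or_disjoint s t by rewrite /eq_or_disjoint (negbTE sNt).
have r_refl : reflexive eq_or_disjoint by move=> x; rewrite /eq_or_disjoint eqxx.
have r_sym : symmetric eq_or_disjoint.
  by move=> x y; rewrite /eq_or_disjoint eq_sym; congr (_ || _); apply: orbC.
suff /allrelP : all2rel eq_or_disjoint E by apply.
rewrite -pairwise_all2rel //; apply: sub_pairwise Ed => x y dis.
by rewrite /eq_or_disjoint dis orbT.
Qed.

Lemma sort_disjoint_segments k E :
  all (is_segment k) E -> pairwise seg_disjoint E ->
  sorted precedes (sort (fun s t => s.1 <= t.1) E).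
Proof.
move=> Ek Ed; have left_total : total (fun s t : segment => s.1 <= t.1).
  by move=> s t; apply: leq_total.
have := sort_pairwise_stable left_total Ed.
apply: sub_in_sorted (allss _) => s t; rewrite !mem_sort => sE tE /= /andP[st].
have [? ? ?] := is_segment_bounds (allP Ek _ sE).
have [? ? ?] := is_segment_bounds (allP Ek _ tE).
have := pairwise_disjoint_in Ed sE tE; rewrite /precedes /seg_disjoint.
by have [->|_ /(_ isT)] := eqVneq s t; [rewrite leqnn|]; lia.
Qed.

Lemma path_precedes_partition k s0 L :
  s0.1 <= s0.2 <= k -> all (is_segment k) L -> path precedes s0 L ->
  (forall p, s0.2 < p <= k -> has (in_seg p) L) ->
  [&& path ltn s0.2 (unzip2 L), last s0.2 (unzip2 L) == k &
      L == pairmap (fun x y => (x.+1, y)) s0.2 (unzip2 L)].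
Proof.
elim: L s0 => [|s L IH] s0 s0k /=.
  by move=> _ _ /(_ s0.2.+1) cover; rewrite andbT; case: eqP => //; lia.
move=> /andP[sk Lk] /andP[s0s sL] cover; have [_ s12 s2k] := is_segment_bounds sk.
have later (t : segment) : t \in L -> s.2 < t.1.
  have valid : all [pred s : segment | s.1 <= s.2] (s :: L).
    by rewrite /= s12; apply: sub_all Lk => u /is_segment_bounds[].
  by move=> tL; have /allP/(_ t tL) := order_path_min_in precedes_trans valid sL.
have s1E : s.1 = s0.2.+1.
  have : has (in_seg s0.2.+1) (s :: L).
    by apply: cover; move: s0s; rewrite /precedes; lia.
  case/hasP => t; rewrite inE => /predU1P[->|/later st].
    by move: s0s; rewrite /precedes /in_seg; lia.
  by move: s0s; rewrite /precedes /in_seg; lia.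
have /and3P[-> -> /eqP <-] : [&& path ltn s.2 (unzip2 L), last s.2 (unzip2 L) == k &
    L == pairmap (fun x y => (x.+1, y)) s.2 (unzip2 L)].
  apply: IH => // [|p pk]; first by rewrite s12.
  have /orP[|//] : has (in_seg p) (s :: L) by apply: cover; lia.
  by rewrite /in_seg; lia.
rewrite -s1E !andbT eqseq_cons eqxx andbT; move: s0s s12; rewrite /precedes.
by case: (s) => a b /=; rewrite eqxx; lia.
Qed.

Lemma sorted_precedes_partition k L :
  all (is_segment k) L -> sorted precedes L ->
  (forall p, 1 <= p <= k -> has (in_seg p) L) -> is_partition k L.
Proof.
move=> Lk sL cover; apply: (@path_precedes_partition k (0, 0)) => //.
case: L Lk sL {cover} => //= s L /andP[/is_segment_bounds[s_gt0 _ _] _] ->.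
by rewrite andbT.
Qed.

Section Lambda.
Variables (k : nat) (E : seq segment).

Lemma mem_Lambda s : (s \in Lambda k E) =
  (s \in E) || [&& s.1 == s.2, 1 <= s.1 <= k & ~~ has (in_seg s.1) E].
Proof.
rewrite mem_sort mem_cat; congr (_ || _).
apply/mapP/idP => [[i]|/and3P[/eqP s12 sk s_free]].
  by rewrite mem_filter mem_iota => /andP[nE ik] -> /=; rewrite eqxx nE; lia.
exists s.1; last by rewrite {2}s12; case: (s).
by rewrite mem_filter s_free mem_iota; lia.
Qed.

Lemma long_mem_Lambda (s : segment) :
  1 < seg_len s -> (s \in Lambda k E) = (s \in E).
Proof.
move=> len; rewrite mem_Lambda (_ : (s.1 == s.2) = false) ?orbF //.
by move: len; rewrite /seg_len; lia.
Qed.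

Lemma Lambda_cover p : 1 <= p <= k -> has (in_seg p) (Lambda k E).
Proof.
move=> pk; apply/hasP; have [/hasP[s sE ps]|p_free] := boolP (has (in_seg p) E).
  by exists s; rewrite // mem_Lambda sE.
exists (p, p); last by rewrite /in_seg leqnn.
by rewrite mem_Lambda /= eqxx p_free pk orbT.
Qed.

Hypotheses (Ek : all (is_segment k) E) (Ed : pairwise seg_disjoint E).

Lemma Lambda_partition : is_partition k (Lambda k E).
Proof.
pose singles := [seq (i, i) | i <- iota 1 k & ~~ has (in_seg i) E].
have singles_k : all (is_segment k) singles.
  apply/allP => s /mapP[i]; rewrite mem_filter mem_iota => /andP[_ ik] ->.
  by rewrite /is_segment /=; lia.
apply: sorted_precedes_partition Lambda_cover.
  by rewrite all_sort all_cat Ek.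
apply: (@sort_disjoint_segments k); first by rewrite all_cat Ek.
rewrite pairwise_cat Ed /=; apply/andP; split.
  apply/allrelP => s t sE /mapP[i]; rewrite mem_filter => /andP[/hasPn i_free _] ->.
  by have := i_free _ sE; rewrite /in_seg /seg_disjoint /=; lia.
have := filter_uniq (fun i => ~~ has (in_seg i) E) (iota_uniq 1 k).
rewrite pairwise_map uniq_pairwise; apply: sub_pairwise => i j.
by rewrite /seg_disjoint /=; lia.
Qed.

End Lambda.

Definition part (L : seq segment) (p : nat) : segment :=
  nth (0, 0) L (find (in_seg p) L).

Section Partition.
Variables (k : nat) (L : seq segment).
Hypothesis Lpart : is_partition k L.

Lemma partition_segment (s : segment) : s \in L -> is_segment k s.
Proof.
move=> sL; have := sL; rewrite -index_mem => /(is_partition_nth Lpart).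
by rewrite nth_index // /is_segment => -[-> -> ->].
Qed.

Lemma partition_cover p : 1 <= p <= k -> has (in_seg p) L.
Proof.
move=> /andP[p1 pk]; have /and3P[_ /eqP last_k _] := Lpart.
have ends_p : has (leq p) (unzip2 L).
  apply/hasP; exists k; rewrite // -last_k.
  have := mem_last 0 (unzip2 L); rewrite inE last_k => /predU1P[k0|//].
  by move: p1 pk; rewrite k0; lia.
have ip := nth_find 0 ends_p; have before_ip := @before_find _ 0 (leq p) (unzip2 L).
move: ends_p; rewrite has_find size_map; set i := find _ _ in ip before_ip * => iL.
have [s_left _ _] := is_partition_nth Lpart iL.
apply/hasP; exists (nth (0, 0) L i); first exact: mem_nth.
rewrite /in_seg s_left -(nth_map (0, 0) 0 snd) // ip andbT.
by case: i before_ip {s_left ip iL} => [//|i] /(_ i (leqnn _)) /=; lia.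
Qed.

Lemma mem_part p : 1 <= p <= k -> part L p \in L.
Proof. by move=> /partition_cover; rewrite has_find; apply: mem_nth. Qed.

Lemma in_part p : 1 <= p <= k -> in_seg p (part L p).
Proof. by move=> /partition_cover/(nth_find (0, 0)). Qed.

Lemma part_eq (s : segment) p : s \in L -> in_seg p s -> part L p = s.
Proof.
move=> sL ps; rewrite /part (@is_partition_find k L (index s L)) ?nth_index //.
by rewrite index_mem.
Qed.

Lemma part_segment p : 1 <= p <= k ->
  [/\ 1 <= (part L p).1, (part L p).1 <= p, p <= (part L p).2 & (part L p).2 <= k].
Proof.
move=> pk; have /is_segment_bounds[? _ ?] := partition_segment (mem_part pk).
by have /andP[] := in_part pk.
Qed.

Lemma part_between (s : segment) p q r : s \in L -> in_seg r s ->
  1 <= p <= k -> 1 <= q <= k -> p <= r <= q -> part L p = part L q -> part L p = s.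
Proof.
move=> sL rs pk qk prq pq; have [_ ? _ _] := part_segment pk.
rewrite -(part_eq sL rs); apply/esym/part_eq; first exact: mem_part.
by have := part_segment qk; rewrite -pq /in_seg => -[_ _ ? _]; lia.
Qed.

Lemma partition_disjoint (s t : segment) :
  s \in L -> t \in L -> s != t -> seg_disjoint s t.
Proof.
move=> sL tL; apply: contraNT; rewrite negb_or -!leqNgt => overlap.
have [_ ? _] := is_segment_bounds (partition_segment sL).
have [_ ? _] := is_segment_bounds (partition_segment tL).
have left_s : in_seg (maxn s.1 t.1) s by rewrite /in_seg; lia.
have left_t : in_seg (maxn s.1 t.1) t by rewrite /in_seg; lia.
by apply/eqP; rewrite -(part_eq sL left_s) (part_eq tL left_t).
Qed.

Lemma part_after (s : segment) : s \in L -> s.2 < k -> (part L s.2.+1).1 = s.2.+1.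
Proof.
move=> sL s2k; have [? ? ?] := is_segment_bounds (partition_segment sL).
have next_k : 1 <= s.2.+1 <= k by lia.
have [_ ? next_le _] := part_segment next_k.
have sN : s != part L s.2.+1 by apply: contraTneq next_le => <-; lia.
have := partition_disjoint sL (mem_part next_k) sN.
by rewrite /seg_disjoint; lia.
Qed.

Lemma part_before (s : segment) : s \in L -> 1 < s.1 -> (part L s.1.-1).2 = s.1.-1.
Proof.
move=> sL s1_gt1; have [? ? ?] := is_segment_bounds (partition_segment sL).
have prev_k : 1 <= s.1.-1 <= k by lia.
have [_ prev_ge ? _] := part_segment prev_k.
have sN : s != part L s.1.-1 by apply: contraTneq prev_ge => <-; lia.
have := partition_disjoint sL (mem_part prev_k) sN.
by rewrite /seg_disjoint; lia.
Qed.

Lemma parts_ordered p q : 1 <= p <= k -> 1 <= q <= k -> p < q ->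
  part L p != part L q -> (part L p).2 < (part L q).1.
Proof.
move=> pk qk pq pNq.
have [_ ? _ _] := part_segment pk; have [_ _ ? _] := part_segment qk.
by have /orP[//|] := partition_disjoint (mem_part pk) (mem_part qk) pNq; lia.
Qed.

End Partition.

(** * The entries of [f_P] *)

Section Entries.
Variables (k : nat) (L : seq segment) (sg : segment -> bool).
Hypothesis Lpart : is_partition k L.

(* The repetition of the part [s] that has level [m], counted from left to right *)
Definition repetition (s : segment) (m : nat) : nat :=
  if sg s then m else k - 1 - m.

(* The index at which [fP] takes the value [m + pi_p / (2 k)], see [fPE] *)
Definition entry (m p : nat) : nat :=
  let s := part L p in
  s.1.-1 * k + repetition s m * seg_len s + (p - s.1.-1).

Lemma repetition_lt s m : m < k -> repetition s m < k.
Proof. by rewrite /repetition; case: (sg s); lia. Qed.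

Lemma repetitionK s m : m < k -> repetition s (repetition s m) = m.
Proof. by rewrite /repetition; case: (sg s); lia. Qed.

Lemma entry_bounds m p : m < k -> 1 <= p <= k ->
  (part L p).1.-1 * k < entry m p <= (part L p).2 * k.
Proof.
move=> mk pk; have [? ? ? _] := part_segment Lpart pk.
have : (repetition (part L p) m).+1 * seg_len (part L p) <= k * seg_len (part L p).
  by rewrite leq_mul2r repetition_lt ?orbT.
have -> : (part L p).2 * k = (part L p).1.-1 * k + k * seg_len (part L p).
  by rewrite [k * _]mulnC -mulnDl; congr (_ * _); rewrite /seg_len; lia.
have lenE : seg_len (part L p) = (part L p).2.+1 - (part L p).1 by [].
by rewrite /entry mulSn; lia.
Qed.

Lemma entry_surj x : 1 <= x <= k ^ 2 ->
  exists m p, [/\ m < k, 1 <= p <= k & x = entry m p].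
Proof.
move=> /andP[x1 xk]; have k0 : 0 < k by case: (k) xk => //; lia.
have cell_k : 1 <= (x.-1 %/ k).+1 <= k.
  by rewrite /= ltn_divLR // mulnn; lia.
set s := part L (x.-1 %/ k).+1; have sL : s \in L := mem_part Lpart cell_k.
have [s_gt0 lo hi sk] := part_segment Lpart cell_k.
rewrite -/s in s_gt0 lo hi sk.
have len0 : 0 < seg_len s by rewrite /seg_len; lia.
pose y := x.-1 - s.1.-1 * k.
have xE : x = (s.1.-1 * k + y).+1.
  suff : s.1.-1 * k <= x.-1 by rewrite /y; lia.
  by rewrite -leq_divRL //; lia.
have y_lt : y %/ seg_len s < k.
  rewrite ltn_divLR // -(ltn_add2l (s.1.-1 * k)) [k * _]mulnC -mulnDl.
  have -> : s.1.-1 + seg_len s = s.2 by rewrite /seg_len; lia.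
  by move: hi; rewrite ltn_divLR // xE.
have y_mod := ltn_pmod y len0.
pose p := s.1.-1 + (y %% seg_len s).+1.
have ps : in_seg p s by rewrite /in_seg /p; move: y_mod; rewrite {2}/seg_len; lia.
exists (repetition s (y %/ seg_len s)), p; split; first exact: repetition_lt.
  exact: (in_seg_bounds (partition_segment Lpart sL) ps).
rewrite /entry (part_eq Lpart sL ps) repetitionK // xE.
by rewrite {1}(divn_eq y (seg_len s)) /p; lia.
Qed.

Lemma entry_level_mono m m' p q : 1 <= p <= k -> 1 <= q <= k ->
  m < k -> m' < k -> part L p = part L q -> entry m p < entry m' q ->
  if sg (part L p) then m <= m' else m' <= m.
Proof.
move=> pk qk mk m'k pq; have [? ? ? _] := part_segment Lpart pk.
have := part_segment Lpart qk; rewrite /entry -pq => -[_ ? ? _] lt_entry.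
have : repetition (part L p) m <= repetition (part L p) m'.
  rewrite leqNgt; apply: contraTN lt_entry => rep_gt; rewrite -leqNgt.
  have : (repetition (part L p) m').+1 * seg_len (part L p)
      <= repetition (part L p) m * seg_len (part L p).
    by rewrite leq_mul2r rep_gt orbT.
  have lenE : seg_len (part L p) = (part L p).2.+1 - (part L p).1 by [].
  by rewrite mulSn; lia.
by rewrite /repetition; case: ifP; lia.
Qed.

Lemma entry_same_level m p q :
  part L p = part L q -> entry m p < entry m q -> p < q.
Proof. by rewrite /entry => ->; lia. Qed.

Lemma entry_part_order m m' p q : 1 <= p <= k -> 1 <= q <= k ->
  m < k -> m' < k -> entry m p < entry m' q -> p <= q \/ part L p = part L q.
Proof.
move=> pk qk mk m'k lt_entry; have [|qp] := leqP p q; [by left|right].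
apply/esym/eqP; apply: contraTT lt_entry => qNp; rewrite -leqNgt.
have q_before_p : (part L q).2 * k <= (part L p).1.-1 * k.
  by rewrite leq_mul2r; have := parts_ordered Lpart qk pk qp qNp; lia.
by have := entry_bounds mk pk; have := entry_bounds m'k qk; lia.
Qed.

Section EntryValues.
Variables (R : realType) (pi : 'S_k).
Local Notation f := (fP pi R L (map sg L)).

Lemma fP_entry m p : m < k -> 1 <= p <= k ->
  f (entry m p) = ((m * (2 * k) + pval pi p)%:R / (2 * k)%:R)%R.
Proof.
move=> mk pk; have := partition_cover Lpart pk; rewrite has_find => pL.
have [s_gt0 lo hi _] := part_segment Lpart pk.
rewrite /entry (@fPE _ _ _ _ _ (find (in_seg p) L)) ?repetition_lt //; last first.
  by move: s_gt0 lo hi; rewrite -/(part L p) /seg_len; lia.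
rewrite (nth_map (0, 0)) // -/(part L p).
rewrite -/(repetition _ (repetition _ m)) repetitionK //.
have -> : (part L p).1.-1 + (p - (part L p).1.-1) = p by lia.
by rewrite [in RHS]natrD mulrDl (natrM _ m) mulfK // pnatr_eq0; lia.
Qed.

Lemma fP_entry_lt m m' p q : m < k -> m' < k -> 1 <= p <= k -> 1 <= q <= k ->
  (f (entry m p) < f (entry m' q))%R =
  (m < m') || (m == m') && (pval pi p < pval pi q).
Proof.
move=> mk m'k pk qk; have k2 : (0 < (2 * k)%:R^-1 :> R)%R.
  by rewrite invr_gt0 ltr0n; lia.
rewrite !fP_entry // ltr_pM2r // ltr_nat.
have := pval_bounds pi pk; have := pval_bounds pi qk.
by have [lt|gt|->] /= := ltngtP m m'; nia.
Qed.

Lemma fP_entry_level m m' p : m' < k -> 1 <= p <= k ->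
  (m%:R < f (entry m' p) < m.+1%:R)%R = (m' == m).
Proof.
move=> m'k pk; have k2 : (0 < (2 * k)%:R :> R)%R by rewrite ltr0n; lia.
rewrite fP_entry // ltr_pdivlMr // ltr_pdivrMr // -!natrM !ltr_nat.
have := pval_bounds pi pk.
by have [lt|gt|->] := ltngtP m' m; nia.
Qed.

(* The [p]-th element of the copy is the entry of level [lev p] above [col p]. *)
Definition grid_copy (lev col : nat -> nat) : Prop :=
  [/\ forall p, 1 <= p <= k -> lev p < k /\ 1 <= col p <= k,
      {in [pred p | 1 <= p <= k] &,
        {homo (fun p => entry (lev p) (col p)) : p q / p < q}} &
      forall p q, 1 <= p <= k -> 1 <= q <= k -> pval pi p < pval pi q ->
        lev p < lev q \/ lev p = lev q /\ pval pi (col p) < pval pi (col q)].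

Lemma copy_grid_copy c : copy pi (k ^ 2) f c ->
  exists lev col, grid_copy lev col /\
    forall p, 1 <= p <= k -> nth 0 c p.-1 = entry (lev p) (col p).
Proof.
case=> c_size c_sorted c_bounds c_order.
have c_index p : 1 <= p <= k -> p.-1 < size c by rewrite c_size; lia.
have /choice[coord coordP] : forall p, exists mq : nat * nat, 1 <= p <= k ->
    [/\ mq.1 < k, 1 <= mq.2 <= k & nth 0 c p.-1 = entry mq.1 mq.2].
  move=> p; have [pk|] := boolP (1 <= p <= k); last by exists (0, 0).
  have [m [q mqP]] := entry_surj (allP c_bounds _ (mem_nth 0 (c_index _ pk))).
  by exists (m, q).
exists (fun p => (coord p).1), (fun p => (coord p).2).
split=> [|p /coordP[]//]; split=> [p /coordP[]//|p q|p q pk qk]; rewrite ?inE.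
  move=> pk qk pq; have [_ _ <-] := coordP p pk; have [_ _ <-] := coordP q qk.
  by apply: (sorted_ltn_nth ltn_trans) => //; rewrite ?inE ?c_index //; lia.
rewrite -c_order //; have [? ? ->] := coordP p pk; have [? ? ->] := coordP q qk.
by rewrite fP_entry_lt // => /orP[->|/andP[/eqP-> ->]]; [left|right].
Qed.

Lemma unique_of_grid_copy : 0 < k ->
  (forall lev col, grid_copy lev col ->
    exists m, forall p, 1 <= p <= k -> lev p = m /\ col p = p) ->
  unique pi R L (map sg L).
Proof.
move=> k0 rigid c cP; have [lev [col [gc cE]]] := copy_grid_copy cP.
have [m level_m] := rigid _ _ gc; have [c_size _ c_bounds _] := cP.
have mk : m < k by have [/(_ 1 k0)[lev_lt _] _ _] := gc; rewrite -(level_m 1 k0).1.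
have c_entry p : 1 <= p <= k -> nth 0 c p.-1 = entry m p.
  by move=> pk; rewrite cE //; have [-> ->] := level_m p pk.
exists m => // x; apply/idP/andP => [xc|[/entry_surj[m' [p [m'k pk ->]]]]].
  split; first exact: (allP c_bounds).
  have ix : index x c < k by rewrite -c_size index_mem.
  by rewrite -(nth_index 0 xc) (c_entry (index x c).+1) // fP_entry_level.
by rewrite fP_entry_level // => /eqP->; rewrite -c_entry // mem_nth // c_size; lia.
Qed.

End EntryValues.
End Entries.

(** * Rigidity of copies *)

Section Rigidity.
Variables (k : nat) (pi : 'S_k) (L : seq segment) (s1 : segment).
Variables (lev col : nat -> nat).
Local Notation sg := (sign_toward pi s1).
Hypotheses (Lpart : is_partition k L) (s1L : s1 \in L).
Hypothesis sign_inversion : forall s : segment, s \in L -> s != s1 ->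
  exists2 p, in_seg p s & inversion pi p (neighbor_toward s1 s) = sg s.
Hypothesis copy_lc : grid_copy L sg pi lev col.

Lemma lev_lt p : 1 <= p <= k -> lev p < k.
Proof. by case: copy_lc => + _ _ => /[apply] -[]. Qed.

Lemma col_bounds p : 1 <= p <= k -> 1 <= col p <= k.
Proof. by case: copy_lc => + _ _ => /[apply] -[]. Qed.

Lemma copy_incr p q : 1 <= p <= k -> 1 <= q <= k -> p < q ->
  entry k L sg (lev p) (col p) < entry k L sg (lev q) (col q).
Proof. by case: copy_lc => _ incr _; apply: incr. Qed.

Lemma lev_le p q : 1 <= p <= k -> 1 <= q <= k -> pval pi p <= pval pi q ->
  lev p <= lev q.
Proof.
move=> pk qk; rewrite leq_eqVlt => /predU1P[/(pval_inj pk qk)-> //|].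
by case: copy_lc => _ _ order /(order _ _ pk qk)[/ltnW|[->]].
Qed.

Lemma col_part_order p q : 1 <= p -> p <= q -> q <= k ->
  col p <= col q \/ part L (col p) = part L (col q).
Proof.
move=> p1; rewrite leq_eqVlt => /predU1P[->|pq] qk; first by right.
have pk : 1 <= p <= k by lia.
have qk' : 1 <= q <= k by lia.
by apply: entry_part_order (copy_incr pk qk' pq) => //; rewrite ?col_bounds ?lev_lt.
Qed.

Lemma lev_eq_of_inversion (s : segment) p q : 1 <= p <= k -> 1 <= q <= k ->
  s \in L -> in_seg (col p) s -> in_seg (col q) s ->
  inversion pi p q = sg s -> lev p = lev q.
Proof.
move=> pk qk sL ps qs inv_pq; have [->//|pNq] := eqVneq p q.
wlog pq : p q pk qk ps qs inv_pq pNq / p < q => [ordered|].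
  have [pq|qp|/eqP] := ltngtP p q; [exact: ordered| |by rewrite (negbTE pNq)].
  by apply/esym/ordered => //; rewrite 1?eq_sym // inversionC.
have := entry_level_mono Lpart (col_bounds pk) (col_bounds qk)
  (lev_lt pk) (lev_lt qk) _ (copy_incr pk qk pq).
rewrite !(part_eq Lpart sL) // -inv_pq /inversion pq addTb => /(_ erefl).
by case: ltnP => [/ltnW/(lev_le pk qk)|/(lev_le qk pk)] /=; lia.
Qed.

Lemma block_lev (s : segment) :
  s \in L -> (forall p, in_seg p s -> in_seg (col p) s) ->
  forall p q, in_seg p s -> in_seg q s -> lev p = lev q.
Proof.
move=> sL s_col; have sk := partition_segment Lpart sL.
have [m_s mE] := argminP pi sk; have [M_s ME] := argmaxP pi sk.
have bounds p : in_seg p s -> 1 <= p <= k := @in_seg_bounds _ _ sk p.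
have lev_mM : lev (argmin pi s) = lev (argmax pi s).
  have [len|short] := ltnP 1 (seg_len s).
    apply: (lev_eq_of_inversion _ _ sL); rewrite ?bounds ?s_col //.
    by rewrite /sign_toward len.
  by congr lev; move: m_s M_s short; rewrite /in_seg /seg_len; lia.
suff lev_m p : in_seg p s -> lev p = lev (argmin pi s).
  by move=> p q /lev_m-> /lev_m->.
move=> ps; have /andP[] := seg_min_max pi sk ps; rewrite -mE -ME.
move=> /(lev_le (bounds _ m_s) (bounds _ ps)) lev_ge.
by move=> /(lev_le (bounds _ ps) (bounds _ M_s)); lia.
Qed.

Lemma col_between (s : segment) x p y : s \in L -> 1 <= x -> x <= p <= y -> y <= k ->
  s.1 <= col x -> col y <= s.2 -> in_seg (col p) s.
Proof.
move=> sL x1 xpy yk sx ys; have sk := partition_segment Lpart sL.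
have [p1 px yp pk] : [/\ 1 <= p, x <= p, p <= y & p <= k] by split; lia.
have cx : 1 <= col x <= k by apply: col_bounds; lia.
have cp : 1 <= col p <= k by apply: col_bounds; lia.
have cy : 1 <= col y <= k by apply: col_bounds; lia.
have := in_part Lpart cp; apply: contraLR.
rewrite negb_and -!ltnNge => /orP[p_left|p_right].
  have [|eq_xp] := col_part_order x1 px pk; first by lia.
  rewrite (part_between Lpart sL (in_seg_left sk) cp cx _ (esym eq_xp)).
    by rewrite negb_and -ltnNge p_left.
  by lia.
have [|eq_py] := col_part_order p1 yp yk; first by lia.
rewrite eq_py (part_between Lpart sL (in_seg_right sk) cy cp _ (esym eq_py)).
  by rewrite negb_and orbC -ltnNge p_right.
by lia.
Qed.

Lemma col_incr (s : segment) a b : s \in L -> 1 <= a -> b <= k ->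
  (forall p, a <= p <= b -> in_seg (col p) s /\ lev p = lev a) ->
  {in [pred p | a <= p <= b] &, {homo col : p q / p < q}}.
Proof.
move=> sL a1 bk block p q; rewrite !inE => pab qab pq.
have [ps lev_p] := block p pab; have [qs lev_q] := block q qab.
have pk : 1 <= p <= k by lia.
have qk : 1 <= q <= k by lia.
have := copy_incr pk qk pq; rewrite lev_p lev_q.
have eq_part : part L (col p) = part L (col q) by rewrite !(part_eq Lpart sL).
exact: entry_same_level eq_part.
Qed.

Lemma level_block_len (s : segment) m a b : s \in L -> 1 <= a -> a <= b -> b <= k ->
  (forall p, a <= p <= b -> in_seg (col p) s /\ lev p = m) -> b - a < seg_len s.
Proof.
move=> sL a1 ab bk block.
have [|/andP[sa _] lev_a] := block a; first by lia.
have [|/andP[_ bs] _] := block b; first by lia.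
suff incr : {in [pred p | a <= p <= b] &, {homo col : p q / p < q}}.
  by have := increasing_gap incr ab; rewrite /seg_len; lia.
by apply: (col_incr sL) => // p /block[]; rewrite lev_a.
Qed.

(* Otherwise [sign_inversion] would put all these entries on one level. *)
Lemma block_no_overflow (s : segment) : s \in L -> s != s1 ->
  ~ (forall p, in_seg p s \/ p = neighbor_toward s1 s -> in_seg (col p) s).
Proof.
move=> sL sNs1 overflow; have sk := partition_segment Lpart sL.
have s1k := partition_segment Lpart s1L.
have dis : seg_disjoint s1 s by apply: (partition_disjoint Lpart); rewrite 1?eq_sym.
have := neighbor_toward_bounds s1k sk dis; have := neighbor_toward_adjacent s1 s.
have [p ps] := sign_inversion sL sNs1.
move: (neighbor_toward s1 s) overflow => e overflow inv_p e_adj e_bounds.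
have s_col q : in_seg q s -> in_seg (col q) s by move=> qs; apply: overflow; left.
have e_col : in_seg (col e) s by apply: overflow; right.
have lev_e : lev p = lev e :=
  lev_eq_of_inversion (in_seg_bounds sk ps) e_bounds sL (s_col _ ps) e_col inv_p.
have lev_p q : in_seg q s \/ q = e -> lev q = lev p.
  by case=> [qs|->//]; apply: (block_lev sL s_col).
have [a [b [a1 ab bk len ab_s]]] := extend_segment sk e_bounds e_adj.
suff : b - a < seg_len s by rewrite ltnNge len.
apply: (@level_block_len s (lev p)) => // q /ab_s qse.
by split; [exact: overflow|exact: lev_p].
Qed.

Lemma col_right_end (s : segment) : s \in L -> s1.2 <= s.2 -> col s.2 <= s.2.
Proof.
have [n] := ubnP (k - s.2); elim: n s => // n IH s kn sL s1s.
have [? ? ?] := is_segment_bounds (partition_segment Lpart sL).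
have [s2k|] := ltnP s.2 k; last by have := @col_bounds s.2; lia.
have next_k : 1 <= s.2.+1 <= k by lia.
have := part_after Lpart sL s2k; have tL := mem_part Lpart next_k.
set t := part L _ in tL * => t1.
have [? ? ?] := is_segment_bounds (partition_segment Lpart tL).
have t_end : col t.2 <= t.2 by apply: IH; lia.
have tNs1 : t != s1 by apply/eqP => eq_t; move: s1s; rewrite -eq_t; lia.
rewrite leqNgt; apply/negP => s_over; apply: (block_no_overflow tL tNs1) => p pte.
apply: (@col_between t s.2 p t.2) => //; rewrite ?t1 //; try lia.
by move: pte; rewrite /in_seg /neighbor_toward t1 ltnS s1s; lia.
Qed.

Lemma col_left_end (s : segment) : s \in L -> s.1 <= s1.1 -> s.1 <= col s.1.
Proof.
have [n] := ubnP s.1; elim: n s => // n IH s sn sL s1s.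
have [? ? ?] := is_segment_bounds (partition_segment Lpart sL).
have [s1_gt1|] := ltnP 1 s.1; last by have := @col_bounds s.1; lia.
have prev_k : 1 <= s.1.-1 <= k by lia.
have := part_before Lpart sL s1_gt1; have tL := mem_part Lpart prev_k.
set t := part L _ in tL * => t2.
have [? ? ?] := is_segment_bounds (partition_segment Lpart tL).
have t_end : t.1 <= col t.1 by apply: IH; lia.
have tNs1 : t != s1 by apply/eqP => eq_t; move: s1s; rewrite -eq_t; lia.
rewrite leqNgt; apply/negP => s_over; apply: (block_no_overflow tL tNs1) => p pte.
have [_ ? _] := is_segment_bounds (partition_segment Lpart s1L).
apply: (@col_between t t.1 p s.1) => //; rewrite ?t2 //; try lia.
by move: pte; rewrite /in_seg /neighbor_toward t2 ifF; lia.
Qed.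

Definition trivial_at (m p : nat) : Prop := lev p = m /\ col p = p.

Lemma block_trivial_at (s : segment) q : s \in L ->
  s.1 <= col s.1 -> col s.2 <= s.2 -> in_seg q s ->
  forall p, in_seg p s -> trivial_at (lev q) p.
Proof.
move=> sL sa sb qs p ps; have sk := partition_segment Lpart sL.
have [s_gt0 _ s2k] := is_segment_bounds sk.
have s_col r : in_seg r s -> in_seg (col r) s.
  by move=> rs; apply: (@col_between s s.1 r s.2).
have s_lev := block_lev sL s_col; split; first exact: s_lev.
apply: (@increasing_fixed col s.1 s.2) => //; apply: (col_incr sL) => // r rs.
by split; [exact: s_col|apply: s_lev => //; exact: in_seg_left sk].
Qed.

(* On the values from [pi_p] to [pi_r], the copy induces an increasing map that
   fixes both ends. *)
Lemma trivial_at_between m p q r :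
  1 <= p <= k -> 1 <= q <= k -> 1 <= r <= k ->
  trivial_at m p -> trivial_at m r -> pval pi p <= pval pi q <= pval pi r ->
  trivial_at m q.
Proof.
move=> pk qk rk [lev_p col_p] [lev_r col_r] pqr; pose inv := pval pi^-1%g.
have pvk := pval_bounds pi pk; have rvk := pval_bounds pi rk.
have inv_bounds v : pval pi p <= v <= pval pi r -> 1 <= inv v <= k.
  by move=> pvr; apply: pval_bounds; lia.
have invK v : pval pi p <= v <= pval pi r -> pval pi (inv v) = v.
  by move=> pvr; apply: pvalVK; lia.
have lev_inv v : pval pi p <= v <= pval pi r -> lev (inv v) = m.
  move=> pvr; have vk := inv_bounds _ pvr.
  by have := lev_le pk vk; have := lev_le vk rk; rewrite invK // lev_p lev_r; lia.
split; first by rewrite -(pvalK pi qk) lev_inv.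
apply: (@pval_inj _ pi); rewrite ?inE ?col_bounds // -{1}(pvalK pi qk).
apply: (@increasing_fixed (fun v => pval pi (col (inv v))) _ _ _ _ _ _ pqr).
- move=> v w pvr pwr vw; have [_ _ order] := copy_lc.
  have := order _ _ (inv_bounds _ pvr) (inv_bounds _ pwr).
  by rewrite !invK // !lev_inv // ltnn => /(_ vw)[|[]].
- by rewrite /inv pvalK // col_p.
- by rewrite /inv pvalK // col_r.
Qed.

Variable E : seq segment.
Hypotheses (entE : entangling pi E) (EL : {subset E <= L}).
Hypothesis s1_head : head (0, 0) E = s1.

Lemma trivial_at_fam m (F : seq segment) q : {subset F <= E} -> F != [::] ->
  (forall p, has (in_seg p) F -> trivial_at m p) ->
  1 <= q <= k -> fam_min pi F <= pval pi q <= fam_max pi F -> trivial_at m q.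
Proof.
move=> FE F0 trivF qk; have [Ek _ _ _ _] := entE.
have Fk : all (is_segment k) F by apply/allP => s /FE/(allP Ek).
have F_bounds p : has (in_seg p) F -> 1 <= p <= k.
  by case/hasP => s /(allP Fk) sk; apply: in_seg_bounds.
have [p pF <-] := fam_min_attained pi Fk F0.
have [r rF <-] := fam_max_attained pi Fk F0.
by apply: trivial_at_between (trivF _ pF) (trivF _ rF) => //; exact: F_bounds.
Qed.

Lemma entangling_trivial_at n p :
  has (in_seg p) (take n E) -> trivial_at (lev s1.1) p.
Proof.
have s1k := partition_segment Lpart s1L; have [Ek _ near_end _ _] := entE.
have [? ? ?] := is_segment_bounds s1k.
elim: n p => [|n IH] p; first by rewrite take0.
have [nE|En] := ltnP n (size E); last first.
  by rewrite !take_oversize // in IH *; [exact: IH|lia].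
rewrite (take_nth (0, 0)) // has_rcons => /orP[|]; last exact: IH.
case: n nE IH => [|n] nE IH.
  rewrite nth0 s1_head; apply: block_trivial_at (in_seg_left s1k) _ => //.
    exact: col_left_end.
  exact: col_right_end.
have tE := mem_nth (0, 0) nE; have tk := allP Ek _ tE; have tL := EL tE.
have F0 : take n.+1 E != [::] by case: (E) nE.
have := near_end n.+1; rewrite nE s1_head => /(_ isT) /=.
set t := nth _ _ _ in tE tk tL *; have [? ? ?] := is_segment_bounds tk.
have ta := in_seg_left tk; have tb := in_seg_right tk.
have fam := trivial_at_fam (@mem_take _ _ _) F0 IH.
case=> [[s1t /andP[lo hi]]|[ts1 /andP[lo hi]]] pt.
  have [|lev_t col_t] := fam t.1 (in_seg_bounds tk ta).
    by rewrite (ltnW lo) (ltnW hi).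
  rewrite -lev_t; apply: block_trivial_at ta _ pt; rewrite ?col_t //.
  by apply: col_right_end => //; lia.
have [|lev_t col_t] := fam t.2 (in_seg_bounds tk tb).
  by rewrite (ltnW lo) (ltnW hi).
rewrite -lev_t; apply: block_trivial_at tb _ pt; rewrite ?col_t //.
by apply: col_left_end => //; lia.
Qed.

Lemma grid_copy_rigid : exists m, forall p, 1 <= p <= k -> lev p = m /\ col p = p.
Proof.
have [Ek _ _ _ cover] := entE; exists (lev s1.1) => p pk.
have [s sE spv] := cover _ (pval_bounds pi pk); have sk := allP Ek _ sE.
have s_triv q : in_seg q s -> trivial_at (lev s1.1) q.
  move=> qs; apply: (@entangling_trivial_at (size E)); rewrite take_size.
  by apply/hasP; exists s.
have [ms mE] := argminP pi sk; have [Ms ME] := argmaxP pi sk.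
apply: trivial_at_between (s_triv _ ms) (s_triv _ Ms) _ => //.
- exact: in_seg_bounds ms.
- exact: in_seg_bounds Ms.
- by rewrite mE ME.
Qed.

End Rigidity.

(** * Entanglings *)

Section Entangling.
Variables (k : nat) (pi : 'S_k) (E : seq segment).
Hypotheses (k_gt0 : 0 < k) (entE : entangling pi E).
Local Notation s1 := (head (0, 0) E).

Lemma head_mem_entangling : s1 \in E.
Proof.
have [_ _ _ _ /(_ 1 k_gt0)[s + _]] := entE.
by case: (E) => // t F _; rewrite mem_head.
Qed.

Lemma head_entangling_long : 1 < size E -> 1 < seg_len s1.
Proof.
move=> E_gt1; have [Ek _ near_end _ _] := entE.
rewrite -(seg_min_lt_max pi (allP Ek _ head_mem_entangling)).
have := near_end 1; rewrite E_gt1 => /(_ isT).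
have -> : take 1 E = [:: s1] by case: (E) E_gt1 => //= t F _; rewrite take0.
rewrite /fam_min /fam_max !big_seq1 big_cons big_nil minnn.
by case=> -[_ /andP[]]; apply: ltn_trans.
Qed.

Lemma sign_inversion_entangling (s : segment) : s \in Lambda k E -> s != s1 ->
  exists2 p, in_seg p s &
    inversion pi p (neighbor_toward s1 s) = sign_toward pi s1 s.
Proof.
have [Ek Ed _ not_shadowed _] := entE; have Lpart := Lambda_partition Ek Ed.
move=> sL sNs1; have sk := partition_segment Lpart sL.
rewrite /sign_toward; case: ltnP => [len|_]; last first.
  by exists s.1 => //; exact: in_seg_left sk.
have sE : s \in E by rewrite -(long_mem_Lambda k).
have s1E := head_mem_entangling; have i0 := index_head_gt0 sE sNs1.
have iE : index s E < size E by rewrite index_mem.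
apply: not_shadowed_inversion => //; first exact: allP Ek _ s1E.
- by apply: pairwise_disjoint_in Ed s1E sE _; rewrite eq_sym.
- by apply: head_entangling_long; apply: leq_ltn_trans iE.
- by have := not_shadowed (index s E); rewrite i0 iE nth_index //; apply.
Qed.

Lemma entangling_unique (R : realType) :
  unique pi R (Lambda k E) (map (sign_toward pi s1) (Lambda k E)).
Proof.
have [Ek Ed _ _ _] := entE; have Lpart := Lambda_partition Ek Ed.
have EL : {subset E <= Lambda k E} by move=> s sE; rewrite mem_Lambda sE.
apply: unique_of_grid_copy => // lev col gc.
apply: (grid_copy_rigid Lpart _ _ gc entE EL) => //.
  exact: EL head_mem_entangling.
exact: sign_inversion_entangling.
Qed.

Lemma entangling_signed :
  signed_partition pi (Lambda k E) (map (sign_toward pi s1) (Lambda k E)).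
Proof.
have [Ek Ed _ _ _] := entE; have Lpart := Lambda_partition Ek Ed.
split; rewrite ?size_map // => i iL /= len.
have sk := partition_segment Lpart (mem_nth (0, 0) iL).
by rewrite (nth_map (0, 0)) // /sign_toward len inversion_argmin_argmax.
Qed.

End Entangling.

Theorem theorem3p8 (R : realType) (k : nat) (k_gt0 : 0 < k) (pi : 'S_k) :
  (forall E : seq segment, entangling pi E ->
    exists S : (size (Lambda k E)).-tuple bool,
      signed_partition pi (Lambda k E) S /\ unique pi R (Lambda k E) S) /\
  d pi <= u pi R.
Proof.
pose signs E := map (sign_toward pi (head (0, 0) E)) (Lambda k E).
have signs_unique E : entangling pi E ->
    signed_partition pi (Lambda k E) (signs E) /\ unique pi R (Lambda k E) (signs E).
  by move=> entE; split; [exact: entangling_signed|exact: entangling_unique].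
split=> [E entE|].
  exists [tuple of map (sign_toward pi (head (0, 0) E)) (in_tuple (Lambda k E))].
  exact: signs_unique.
apply/bigmax_leqP => n /asboolP[E entE dEn].
apply: (@leq_bigmax_cond _ _ (fun i : 'I_k.+1 => i : nat)); apply/asboolP.
by exists (Lambda k E), (signs E); have [] := signs_unique E entE.
Qed.
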